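(* Let $(Z,d,\nu)$ be a compact metric measure space with $\nu$ a doubling Borel regular measure, and let $0<s<1$. If $E\subset Z$ is such that $\chi_E\in B^s_{1,1}(Z)$, then $\mathcal{H}^{-s}(\partial^*E)=0$.
   Context: A measure $\nu$ is doubling if there is $C_\nu\ge1$ with $0<\nu(B(x,2r))\le C_\nu\,\nu(B(x,r))<\infty$ for all $x\in Z$, $r>0$. For $0<s<1$, $B^s_{1,1}(Z)$ consists of those $u\in L^1(Z)$ with $\int_Z\int_Z\frac{|u(y)-u(x)|}{d(x,y)^s\,\nu(B(x,d(x,y)))}\,d\nu(y)\,d\nu(x)<\infty$. The measure-theoretic boundary $\partial^*E$ is the set of $x\in Z$ with $\limsup_{r\to0^+}\frac{\nu(B(x,r)\cap E)}{\nu(B(x,r))}>0$ and $\limsup_{r\to0^+}\frac{\nu(B(x,r)\setminus E)}{\nu(B(x,r))}>0$. For $t>0$, the codimension $t$ Hausdorff content is $\mathcal{H}^{-t}_r(A)=\inf\{\sum_i\frac{\nu(B_i)}{\mathrm{rad}(B_i)^t}: A\subset\bigcup_iB_i,\ \mathrm{rad}(B_i)\le r\}$ (countable covers by balls) and the codimension $t$ Hausdorff measure is $\mathcal{H}^{-t}(A)=\lim_{r\to0^+}\mathcal{H}^{-t}_r(A)$. *)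

(* Defs.v *)
From HB Require Import structures.
From mathcomp Require Import all_boot all_order all_algebra.
From mathcomp Require Import all_classical all_reals all_analysis.
Set Implicit Arguments. Unset Strict Implicit. Unset Printing Implicit Defensive.
Import Order.TTheory GRing.Theory Num.Theory.
Local Open Scope classical_set_scope.
Local Open Scope ring_scope.

Definition is_metric (R : realType) (Z : Type) (dist : Z -> Z -> R) : Prop :=
  [/\ forall x y, 0 <= dist x y,
      forall x y, dist x y = 0 <-> x = y,
      forall x y, dist x y = dist y x &
      forall x y z, dist x z <= dist x y + dist y z].

Definition mball (R : realType) (Z : Type) (dist : Z -> Z -> R) (x : Z) (r : R)
  : set Z := [set y | dist x y < r].

Definition mopen (R : realType) (Z : Type) (dist : Z -> Z -> R) (U : set Z) : Prop :=
  forall x, U x -> exists2 r, 0 < r & mball dist x r `<=` U.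

Definition mcompact (R : realType) (Z : Type) (dist : Z -> Z -> R) : Prop :=
  forall (I : Type) (U : I -> set Z),
    (forall i, mopen dist (U i)) -> setT `<=` \bigcup_i U i ->
    exists (n : nat) (f : nat -> I),
      setT `<=` \bigcup_(k in [set k : nat | (k < n)%N]) U (f k).

Definition mborel (R : realType) (Z : Type) (dist : Z -> Z -> R) : set (set Z) :=
  <<s [set U | mopen dist U] >>.

Definition borel_regular (R : realType) (d : measure_display) (Z : measurableType d)
  (dist : Z -> Z -> R) (nu : set Z -> \bar R) : Prop :=
  (forall B, mborel dist B -> measurable B) /\
  (forall A, measurable A -> exists B, [/\ mborel dist B, A `<=` B & nu A = nu B]).

Definition doubling (R : realType) (Z : Type) (dist : Z -> Z -> R)
  (nu : set Z -> \bar R) : Prop :=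
  exists C : R, 1 <= C /\ forall x r, 0 < r ->
    [/\ (0 < nu (mball dist x (2 * r)))%E,
        (nu (mball dist x (2 * r)) <= C%:E * nu (mball dist x r))%E &
        (C%:E * nu (mball dist x r) < +oo)%E].

(* Besov space B^s_{1,1}(Z).  The integrand is 0 on the diagonal
   (0 / 0 = 0 in MathComp), matching |u(x)-u(x)| = 0. *)
Definition besov_kernel (R : realType) (d : measure_display) (Z : measurableType d)
  (dist : Z -> Z -> R) (nu : set Z -> \bar R) (s : R) (u : Z -> R) (x y : Z) : R :=
  `|u y - u x| / (dist x y `^ s * fine (nu (mball dist x (dist x y)))).

Definition besov11 (R : realType) (d : measure_display) (Z : measurableType d)
  (dist : Z -> Z -> R) (nu : {measure set Z -> \bar R}) (s : R) (u : Z -> R) : Prop :=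
  nu.-integrable setT (EFin \o u) /\
  (\int[nu]_x \int[nu]_y (besov_kernel dist nu s u x y)%:E < +oo)%E.

Definition limsup0 (R : realType) (f : R -> R) : \bar R :=
  ereal_inf [set ereal_sup [set (f r)%:E | r in `]0, delta[ ] | delta in `]0, +oo[].

Definition mboundary (R : realType) (d : measure_display) (Z : measurableType d)
  (dist : Z -> Z -> R) (nu : set Z -> \bar R) (E : set Z) : set Z :=
  [set x | (0 < limsup0 (fun r => (fine (nu (mball dist x r `&` E)) /
                                  fine (nu (mball dist x r)))%R))%E /\
           (0 < limsup0 (fun r => (fine (nu (mball dist x r `\` E)) /
                                  fine (nu (mball dist x r)))%R))%E].

Definition hcontent (R : realType) (Z : Type) (dist : Z -> Z -> R)
  (nu : set Z -> \bar R) (t r : R) (A : set Z) : \bar R :=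
  ereal_inf [set S | exists (J : set nat) (c : nat -> Z) (rho : nat -> R),
     [/\ A `<=` \bigcup_(i in J) mball dist (c i) (rho i),
         (forall i, J i -> 0 < rho i <= r) &
         S = (\esum_(i in J) (nu (mball dist (c i) (rho i)) * ((rho i `^ t)^-1)%:E))%E]].

Definition hmeasure (R : realType) (Z : Type) (dist : Z -> Z -> R)
  (nu : set Z -> \bar R) (t : R) (A : set Z) : \bar R :=
  lim (hcontent dist nu t r A @[r --> 0^'+]).

(* Main.v *)
Require Import Defs.
From HB Require Import structures.
From mathcomp Require Import all_boot all_order all_algebra.
From mathcomp Require Import all_classical all_reals all_analysis.
From mathcomp Require Import measurable_realfun ring lra.
Set Implicit Arguments. Unset Strict Implicit.
Unset Printing Implicit Defensive.
Import Order.TTheory GRing.Theory Num.Theory.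
Local Open Scope classical_set_scope.
Local Open Scope ring_scope.

(* Points of the measure-theoretic boundary see both E and its complement with
   a fixed proportion in arbitrarily small balls of dyadic radius.  For such a
   ball B = B(x, r) the part of the Besov energy of scale r carried by B is
   bounded below by a multiple of nu(B) / r^s.  At each dyadic scale the bad
   points are covered by finitely many balls B(x_i, 2r) with the B(x_i, r)
   disjoint, so their content is at most a multiple of the energy at that scale.
   The energies of the scales are summable, and the tails of the series bound
   the content of the points that are bad at infinitely many scales. *)

(** * Countable subadditivity of the Hausdorff content *)

Section hausdorff_content.
Context (R : realType) (Z : Type) (dist : Z -> Z -> R) (nu : set Z -> \bar R).
Hypothesis nu_ge0 : forall A, (0 <= nu A)%E.
Implicit Types (A : set Z) (t r : R).

Let hsummand_ge0 t (x : Z) r :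
  (0 <= nu (mball dist x r) * ((r `^ t)^-1)%:E)%E.
Proof. by rewrite mule_ge0// lee_fin invr_ge0 powR_ge0. Qed.

Lemma hcontent_ge0 t r A : (0 <= hcontent dist nu t r A)%E.
Proof.
by apply: le_ereal_inf_tmp => _ [J [c [rho [_ _ ->]]]]; exact: esum_ge0.
Qed.

Lemma le_hcontent t r A B : A `<=` B ->
  (hcontent dist nu t r A <= hcontent dist nu t r B)%E.
Proof.
move=> AB; apply: ereal_inf_le_tmp => _ [J [c [rho [BJ Jr ->]]]].
by exists J, c, rho; split => //; exact: subset_trans BJ.
Qed.

Lemma hcontent_le_seq (z0 : Z) t r A (s : seq Z) (q : R) : 0 < q <= r ->
  A `<=` [set x | exists2 i, (i < size s)%N & mball dist (nth z0 s i) q x] ->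
  (hcontent dist nu t r A <=
    \sum_(x <- s) nu (mball dist x q) * ((q `^ t)^-1)%:E)%E.
Proof.
move=> qr As; apply: ereal_inf_lbound.
exists [set i | (i < size s)%N], (nth z0 s), (fun=> q); split => //.
rewrite esum_fset; [|exact: finite_II|by move=> *; exact: hsummand_ge0].
by rewrite -fsbig_ord (big_nth z0) big_mkord.
Qed.

(** Each [A n] gets a cover that is optimal up to [e / 2 ^ n.+1]; together these covers form one
    countable cover of the union, and the errors add up to at most [e]. *)
Lemma hcontent_sigma_subadditive t r (A : (set Z)^nat) :
  (hcontent dist nu t r (\bigcup_n A n) <=
    \sum_(n <oo) hcontent dist nu t r (A n))%E.
Proof.
have [[i ioo]|] := pselect (exists i, hcontent dist nu t r (A i) = +oo%E).
  rewrite (eseries_pinfty _ _ ioo) ?leey// => n _.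
  by rewrite -ltNye (lt_le_trans _ (hcontent_ge0 _ _ _)).
rewrite -forallNE => Aoo; apply/lee_addgt0Pr => e e0.
rewrite (le_trans _ (epsilon_trick _ _ _))//; last 2 first.
  by move=> n; exact: hcontent_ge0.
  exact: ltW.
pose Cov : Type := (set nat * (nat -> Z) * (nat -> R))%type.
pose val (D : Cov) i :=
  (nu (mball dist (D.1.2 i) (D.2 i)) * ((D.2 i `^ t)^-1)%:E)%E.
pose P n (D : Cov) := [/\
  A n `<=` \bigcup_(i in D.1.1) mball dist (D.1.2 i) (D.2 i),
  (forall i, D.1.1 i -> 0 < D.2 i <= r) &
  (\esum_(i in D.1.1) val D i <=
     hcontent dist nu t r (A n) + (e / (2 ^ n.+1)%:R)%:E)%E].
have [G PG] : {G : nat -> Cov & forall n, P n (G n)}.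
  apply: (@choice _ _ P) => n; rewrite /P.
  have en0 : 0 < e / (2 ^ n.+1)%:R by rewrite divr_gt0// ltr0n expn_gt0.
  have fin : hcontent dist nu t r (A n) \is a fin_num.
    rewrite ge0_fin_numE ?hcontent_ge0// ltey; exact/eqP.
  have [x [J [c [rho [AJ Jr ->]]]] xS] := lb_ereal_inf_adherent en0 fin.
  by exists (J, c, rho); split => //=; exact: ltW.
(* A bijection [f] from [nat] to [nat * nat] lists the doubly indexed balls as a single sequence, as
   the definition of the content requires. *)
have /card_esym/ppcard_eqP[f] := card_nat2.
pose J := [set: nat] `*`` (fun n => (G n).1.1).
apply: (@le_trans _ _ (\esum_(k in J) val (G k.1) k.2)).
  apply: ereal_inf_lbound; exists (f @^-1` J),
    (fun i => (G (f i).1).1.2 (f i).2), (fun i => (G (f i).1).2 (f i).2).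
  split.
  - move=> x [n _ Anx]; have [Gn _ _] := PG n.
    have [i Ji xi] := Gn _ Anx.
    by exists (f^-1%FUN (n, i)); rewrite /= invK ?inE.
  - by move=> i [_ Ji]; have [_ + _] := PG (f i).1; exact.
  - rewrite (reindex_esum (f @^-1` J) J f)//; split => //.
    + by move=> x y _ _ /(congr1 f^-1%FUN); rewrite !funK ?inE.
    + by move=> k Jk; exists (f^-1%FUN k); rewrite /= invK ?inE.
rewrite -(esum_esum (a := fun n i => val (G n) i)); last first.
  by move=> *; exact: hsummand_ge0.
rewrite -nneseries_esumT; last first.
  by move=> n; apply: esum_ge0 => *; exact: hsummand_ge0.
apply: lee_nneseries => n *; last by have [] := PG n.
by apply: esum_ge0 => *; exact: hsummand_ge0.
Qed.

End hausdorff_content.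

(** * Dyadic scales *)

(** Here [e], [f] and [b] stand for the masses of the set, of its complement and of the whole ball
    at dyadic radii. The two upper densities may be positive along different scales; doubling forces
    scales common to both. *)
Lemma frequently_both_ge (R : realFieldType) (C a : R) (e f b : nat -> R) :
  1 <= C -> 0 < a ->
  (forall j, 0 < b j) -> (forall j, b j = e j + f j) ->
  (forall j, b j <= C * b j.+1) -> (forall j, f j.+1 <= f j) ->
  (forall m, exists2 j, (m <= j)%N & a * b j <= e j) ->
  (forall m, exists2 j, (m <= j)%N & a * b j <= f j) ->
  exists2 g, 0 < g &
    forall m, exists2 j, (m <= j)%N & g * b j <= e j /\ g * b j <= f j.
Proof.
move=> C1 a0 b0 bE bC fS ea fa; pose mu := Num.min a 2^-1.
have mu0 : 0 < mu by rewrite lt_min a0 invr_gt0 ltr0n.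
have mua : mu <= a by rewrite ge_min lexx.
have mu2 : mu <= 2^-1 by rewrite ge_min lexx orbT.
have C0 : 0 < C by exact: lt_le_trans C1.
have gmu : mu / C <= mu by rewrite ler_pdivrMr// ler_peMr// ltW.
exists (mu / C); first by rewrite divr_gt0.
move=> m; have [j1 mj1 ej1] := ea m.
have [j2 j12 fj2] := fa j1.
pose P j := (j1 <= j)%N && (mu * b j <= f j).
have exP : exists j, P j.
  exists j2; rewrite /P j12 (le_trans _ fj2)//.
  by rewrite ler_wpM2r// ltW.
(* At the first scale [j] after [j1] where [f] is large, [e] is large too if
   [j = j1]; otherwise [f] is small, hence [e] large, one scale earlier, where
   [f] is still comparable to its value at [j] by doubling. *)
case: (ex_minnP exP) => j /andP[j1j fj] minj.
have [jj1|jj1] := eqVneq j j1.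
  exists j; first by rewrite jj1.
  split; last by apply: le_trans fj; rewrite ler_wpM2r// ltW.
  rewrite jj1; apply: le_trans ej1; apply: ler_wpM2r; first exact: ltW.
  exact: le_trans mua.
have {jj1}j1j' : (j1 < j)%N by rewrite ltn_neqAle eq_sym jj1.
case: j j1j fj minj j1j' => // k _ fk mink j1k.
exists k; first exact: leq_trans mj1 _.
have fk2 : f k < mu * b k.
  rewrite ltNge; apply/negP => fk2.
  by have := mink k; rewrite /P fk2 andbT -ltnS j1k ltnn => /(_ isT).
split.
  have : mu * b k <= 2^-1 * b k by rewrite ler_wpM2r// ltW.
  have : mu / C * b k <= mu * b k by rewrite ler_wpM2r// ltW.
  by have := bE k; lra.
apply: le_trans (fS k); apply: le_trans fk.
rewrite -mulrA ler_pM2l// mulrC ler_pdivrMr// mulrC; exact: bC.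
Qed.

Lemma half_expr_lt (R : realType) (r : R) : 0 < r -> exists n, 2^-1 ^+ n < r.
Proof.
move=> r0; exists (Num.bound r^-1); rewrite exprVn invf_plt ?posrE ?exprn_gt0//.
rewrite (lt_trans (archi_boundP _)) ?invr_ge0 ?(ltW r0)//.
by rewrite -natrX ltr_nat ltn_expl.
Qed.

Lemma half_expr_bracket (R : realType) (m : nat) (r : R) :
  0 < r < 2^-1 ^+ m.+1 ->
  exists2 j, (m <= j)%N & 2^-1 ^+ j.+2 <= r < 2^-1 ^+ j.+1.
Proof.
move=> /andP[r0 rm].
have exP : exists n, 2^-1 ^+ n <= r.
  by have [n /ltW nr] := half_expr_lt r0; exists n.
case: (ex_minnP exP) => n nr minn.
have mn : (m.+1 < n)%N.
  rewrite ltnNge; apply/negP => nm.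
  move: rm; rewrite ltNge => /negP; apply; apply: le_trans nr.
  by rewrite ler_wiXn2l// ?invr_ge0 ?invf_le1 ?ler1n ?ler0n.
case: n nr minn mn => [|[|j]]// jr minj mj; exists j => //.
by rewrite jr ltNge/=; apply/negP => /minj; rewrite ltnn.
Qed.

(** A radius [r] with large ratio lies between [2^-(j+2)] and [2^-(j+1)]. Enlarging it to [2^-(j+1)]
    does not decrease [e], and doubling bounds the growth of [b] by the factor [C]. *)
Lemma limsup0_gt0_dyadic (R : realType) (C : R) (e b : R -> R) :
  0 < C -> (forall r, 0 < r -> 0 < b r) ->
  (forall r, 0 < r -> b (2 * r) <= C * b r) ->
  {homo e : x y / x <= y} -> {homo b : x y / x <= y} ->
  (0 < limsup0 (fun r => (e r / b r)%R))%E ->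
  exists2 a, 0 < a & forall m, exists2 j, (m <= j)%N &
    a * b (2^-1 ^+ j.+1) <= e (2^-1 ^+ j.+1).
Proof.
move=> C0 b0 bC eh bh; set L := limsup0 _ => L0.
(* As an extended real, [L] may be infinite; any positive [a] then works. *)
have [a a0 aL] : exists2 a : R, 0 < a & (a%:E < L)%E.
  case: L L0 => [l|_|//]; last by exists 1 => //; rewrite ltry.
  by rewrite lte_fin => l0; exists (l / 2); rewrite ?lte_fin; lra.
exists (a / C); first by rewrite divr_gt0.
move=> m; set d : R := 2^-1 ^+ m.+1.
have d0 : 0 < d by rewrite exprn_gt0 ?invr_gt0.
pose S := [set (e r / b r)%:E | r in `]0, d[].
have : (a%:E < ereal_sup S)%E.
  apply: (lt_le_trans aL); apply: ereal_inf_lbound; exists d => //=.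
  by rewrite in_itv/= d0.
move=> /ereal_sup_gt[_ [r + <-]]; rewrite /= in_itv/= lte_fin => rd ar.
have [j mj /andP[jr rj]] := half_expr_bracket rd.
have r0 : 0 < r by case/andP: rd.
exists j => //; apply: (@le_trans _ _ (e r)); last exact/eh/ltW.
have := ar; rewrite ltr_pdivlMr ?b0// => /ltW; apply: le_trans.
rewrite -mulrA ler_pM2l// mulrC ler_pdivrMr// mulrC.
apply: (@le_trans _ _ (C * b (2^-1 ^+ j.+2))); last by rewrite ler_pM2l// bh.
have -> : 2^-1 ^+ j.+1 = 2 * 2^-1 ^+ j.+2 :> R.
  by rewrite [in RHS]exprS mulrA divff ?mul1r.
by rewrite bC ?exprn_gt0 ?invr_gt0.
Qed.

(** * Covering by balls with separated centres *)

(** Induction on the number of covering balls. If the last one meets [A] at [x], then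
    [mball dist x (2 * q)] contains it, so the rest of [A] outside this larger ball is covered by
    the first [n] balls and stays at distance at least [2 * q] from [x]. *)
Lemma separated_cover (R : realType) (Z : Type) (dist : Z -> Z -> R) (z0 : Z)
    (n : nat) (p : nat -> Z) (q : R) (A : set Z) : is_metric dist ->
  A `<=` \bigcup_(k in [set k | (k < n)%N]) mball dist (p k) q ->
  exists s : seq Z, [/\ forall i, (i < size s)%N -> A (nth z0 s i),
    forall i j, (i < size s)%N -> (j < size s)%N -> i != j ->
      2 * q <= dist (nth z0 s i) (nth z0 s j) &
    A `<=` [set x | exists2 i, (i < size s)%N &
                      mball dist (nth z0 s i) (2 * q) x]].
Proof.
move=> [_ _ dC dT]; elim: n A => [|n IH] A An.
  by exists [::]; split => // x /An[].
have [[x [Ax xn]]|noA] := pselect (exists x, A x /\ mball dist (p n) q x);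
    last first.
  apply: IH => x Ax; have [k /= kn xk] := An _ Ax.
  exists k => //=; rewrite ltn_neqAle -ltnS kn andbT.
  by apply/eqP => kE; apply: noA; exists x; rewrite -kE.
have [y [Ay yx]|s [sA sep As]] := IH (A `\` mball dist x (2 * q)).
  have [k /= kn yk] := An _ Ay; exists k => //=.
  rewrite ltn_neqAle -ltnS kn andbT; apply/eqP => kE; apply: yx.
  move: yk xn; rewrite kE /mball/= => yk xn.
  by have := dT x (p n) y; rewrite (dC x (p n)); lra.
have xs i : (i < size s)%N -> 2 * q <= dist x (nth z0 s i).
  by move=> /sA[_]; rewrite /mball/= => /negP; rewrite -leNgt.
exists (x :: s); split.
- by case=> [//|i] /sA[].
- case=> [|i] [|j]//=; rewrite !ltnS.
  + by move=> _ /xs.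
  + by move=> /xs + _ _; rewrite dC.
  + by move=> is_ js ij; apply: sep.
- move=> y Ay; have [xy|xy] := pselect (mball dist x (2 * q) y).
    by exists 0%N.
  by have [i si yi] := As y (conj Ay xy); exists i.+1.
Qed.

(** * Two tools for estimating the energy *)

(** The integral of a nonnegative function is a supremum over the simple functions below it, hence
    monotone for arbitrary integrands. This allows comparisons with the Besov kernel and with its
    inner integral. *)
Lemma ge0_le_lower_integral (R : realType) (d : measure_display)
    (T : measurableType d) (mu : {measure set T -> \bar R}) (f g : T -> \bar R) :
  (forall x, 0 <= f x)%E -> (forall x, f x <= g x)%E ->
  (\int[mu]_x f x <= \int[mu]_x g x)%E.
Proof.
move=> f0 fg; have g0 x : (0 <= g x)%E by exact: le_trans (fg x).
rewrite !ge0_integralTE//; apply: ereal_sup_le => _ [h /= hf <-].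
by exists h => //= x; exact: le_trans (fg x).
Qed.

(** The nonzero terms form an increasing geometric progression, so their sum is at most [(1 - p)^-1]
    times the last of them, whose scale still exceeds [t]. *)
Lemma sum_dyadic_powR_le (R : realType) (s t : R) (N : nat) : 0 < s -> 0 < t ->
  \sum_(k < N) (if t < 2^-1 ^+ k then ((2^-1 ^+ k) `^ s)^-1 else 0) <=
  (1 - 2^-1 `^ s)^-1 * (t `^ s)^-1.
Proof.
move=> s0 t0; set p : R := 2^-1 `^ s.
have p0 : 0 < p by rewrite powR_gt0// invr_gt0.
have p1 : 0 < 1 - p.
  rewrite subr_gt0 -[ltRHS](congr1 (@^~ s) (powR1 R)).
  by rewrite gt0_ltr_powR// ?nnegrE ?invr_ge0// invf_lt1// ltr1n.
have pE k : (2^-1 ^+ k) `^ s = p ^+ k.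
  elim: k => [|k IH]; first by rewrite !expr0 powR1.
  by rewrite !exprS powRM ?exprn_ge0 ?invr_ge0// IH.
have geo k : \sum_(i < k.+1) (p ^+ i)^-1 <= (1 - p)^-1 * (p ^+ k)^-1.
  elim: k => [|k IH].
    by rewrite big_ord_recr big_ord0 /= expr0 add0r invr1 mulr1 invf_ge1//; lra.
  rewrite big_ord_recr/=; apply: le_trans (lerD IH (lexx _)) _.
  rewrite le_eqVlt; apply/orP; left; apply/eqP.
  have pk : p ^+ k != 0 by rewrite expf_neq0// gt_eqF.
  rewrite exprS; field.
  by rewrite pk (gt_eqF p0) (gt_eqF p1).
have ts : 0 < t `^ s by rewrite powR_gt0.
elim: N => [|N IH].
  by rewrite big_ord0 mulr_ge0// invr_ge0 ltW.
have [tN|tN] := ltP t (2^-1 ^+ N); last first.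
  by rewrite big_ord_recr/= ltNge tN addr0.
apply: (@le_trans _ _ (\sum_(i < N.+1) (p ^+ i)^-1)).
  apply: ler_sum => i _; rewrite pE; case: ifP => //.
  by rewrite invr_ge0 exprn_ge0// ltW.
apply: le_trans (geo N) _.
rewrite ler_pM2l ?invr_gt0// lef_pV2 ?posrE ?exprn_gt0//.
by rewrite -pE ltW// gt0_ltr_powR// nnegrE ?exprn_ge0 ?invr_ge0// ltW.
Qed.

(** * Balls of a doubling measure and measurability of their masses *)

Section doubling_metric_space.
Context (R : realType) (d : measure_display) (Z : measurableType d).
Context (dist : Z -> Z -> R) (nu : {measure set Z -> \bar R}) (C : R).
Hypotheses (distP : is_metric dist)
  (measurable_open : forall U, mopen dist U -> measurable U)
  (C1 : 1 <= C)
  (nuP : forall x r, 0 < r ->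
    [/\ (0 < nu (mball dist x (2 * r)))%E,
        (nu (mball dist x (2 * r)) <= C%:E * nu (mball dist x r))%E &
        (C%:E * nu (mball dist x r) < +oo)%E]).

Local Notation ball := (mball dist).
Local Notation mass x r A := (fine (nu (mball dist x r `&` A))).
Local Notation vol x r := (fine (nu (mball dist x r))).

Lemma le_mball x : {homo ball x : r q / r <= q >-> r `<=` q}.
Proof. by move=> r q rq y; rewrite /mball/= => /lt_le_trans; exact. Qed.

Lemma mball_sub x y r q : ball x r y -> ball y q `<=` ball x (r + q).
Proof.
case: distP => _ _ _ dT; rewrite /mball/= => xy z /= yz.
by have := dT x y z; lra.
Qed.

Lemma mball_sym x y r : ball x r y -> ball y r x.
Proof. by case: distP => _ _ dC _; rewrite /mball/= dC. Qed.

Lemma mopen_mball x r : mopen dist (ball x r).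
Proof.
move=> y xy; exists (r - dist x y); first by rewrite subr_gt0.
case: distP => _ _ _ dT z; move: xy; rewrite /mball/= => xy yz.
by have := dT x y z; lra.
Qed.

Lemma measurable_mball x r : measurable (ball x r).
Proof. exact/measurable_open/mopen_mball. Qed.
Local Hint Resolve measurable_mball : core.

Let C0 : 0 < C. Proof. exact: lt_le_trans C1. Qed.

Lemma nu_mball_lty x r : (nu (ball x r) < +oo)%E.
Proof.
pose q := Num.max r 1.
have q0 : 0 < q by rewrite lt_max ltr01 orbT.
apply: (@le_lt_trans _ _ (nu (ball x q))).
  by rewrite le_measure ?inE//; apply: le_mball; rewrite le_max lexx.
have [_ _] := nuP x q0; apply: le_lt_trans.
by rewrite -[leLHS]mul1e lee_wpmul2r ?lee_fin.
Qed.

Lemma nu_mball_fin x r : nu (ball x r) \is a fin_num.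
Proof. by rewrite ge0_fin_numE// nu_mball_lty. Qed.

Lemma nu_mballI_fin x r A : measurable A -> nu (ball x r `&` A) \is a fin_num.
Proof.
move=> mA; rewrite ge0_fin_numE//; apply: le_lt_trans (nu_mball_lty x r).
by rewrite le_measure ?inE//; exact: measurableI.
Qed.

Lemma vol_gt0 x r : 0 < r -> 0 < vol x r.
Proof.
move=> r0; rewrite -lte_fin fineK ?nu_mball_fin//.
have r20 : 0 < r / 2 by rewrite divr_gt0.
by have [+ _ _] := nuP x r20; rewrite mulrC divfK.
Qed.

Lemma vol_doubling x r : 0 < r -> vol x (2 * r) <= C * vol x r.
Proof.
move=> r0; rewrite -lee_fin EFinM !fineK ?nu_mball_fin//.
by have [_ + _] := nuP x r0.
Qed.

Lemma le_mass x y r q A : measurable A -> ball x r `<=` ball y q ->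
  mass x r A <= mass y q A.
Proof.
move=> mA xy; rewrite fine_le ?nu_mballI_fin// le_measure ?inE//.
- exact: measurableI.
- exact: measurableI.
- exact: setSI.
Qed.

Lemma le_vol x y r q : ball x r `<=` ball y q -> vol x r <= vol y q.
Proof. by move=> xy; rewrite fine_le ?nu_mball_fin// le_measure ?inE. Qed.

Lemma vol_mass x r A : measurable A -> vol x r = mass x r A + mass x r (~` A).
Proof.
move=> mA; have mAC := measurableC mA.
rewrite -fineD ?nu_mballI_fin// -measureU ?setIUr//; try exact: measurableI.
- by rewrite -setIUr setUv setIT.
- by rewrite setIACA setICr setI0.
Qed.

(* The map is lower semicontinuous: an open ball is the increasing union of the
   balls of radius [r - 1/(n+1)], each of which survives a small move of the
   center. *)
Lemma measurable_nu_mballI r A : measurable A ->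
  measurable_fun setT (fun y => nu (ball y r `&` A)).
Proof.
move=> mA; apply: (measurability _ (ErealGenOInfty.measurableE R)).
move=> /= _ [_ [a ->]] <-; apply: measurableI => //; apply: measurable_open.
rewrite preimage_itvoy => y /= ay.
pose F n := ball y (r - n.+1%:R^-1) `&` A.
have mF n : measurable (F n) by exact: measurableI.
have ndF : nondecreasing_seq F.
  move=> m n mn; apply/subsetPset; apply: setSI; apply: le_mball.
  by rewrite lerD2l lerN2 lef_pV2 ?posrE ?ltr0n// ler_nat ltnS.
have FE : \bigcup_n F n = ball y r `&` A.
  apply/seteqP; split => z.
    move=> [n _ [yz Az]]; split => //; apply: le_mball yz.
    by rewrite gerBl invr_ge0.
  move=> [yz Az]; have r0 : 0 < r - dist y z by rewrite subr_gt0.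
  have [n nr] := half_expr_lt r0; exists (2 ^ n)%N => //; split => //.
  rewrite /mball/= ltrBrDl -ltrBrDr; apply: lt_trans nr.
  by rewrite exprVn ltf_pV2 ?posrE ?exprn_gt0 ?ltr0n// -natrX ltr_nat.
have mBA : measurable (ball y r `&` A) by exact: measurableI.
have := @nondecreasing_cvg_mu _ _ _ nu F mF; rewrite FE => /(_ mBA ndF) cvF.
have [n an] : exists n, (a%:E < nu (F n))%E.
  apply: contrapT => /forallNP noF.
  have : (nu (ball y r `&` A) <= a%:E)%E.
    rewrite -(cvg_lim _ cvF)//; apply: lime_le.
      by apply/cvg_ex; eexists; exact: cvF.
    by near=> n; rewrite /= leNgt; apply/negP/noF.
  by rewrite leNgt ay.
exists n.+1%:R^-1; first by rewrite invr_gt0.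
move=> z yz; apply: (lt_le_trans an); rewrite le_measure ?inE//.
  exact: measurableI.
apply: setSI; apply: subset_trans (mball_sub (mball_sym yz)) _.
by rewrite addrC subrK.
Unshelve. all: by end_near. Qed.

Lemma measurable_mass r A : measurable A ->
  measurable_fun setT (fun y => mass y r A).
Proof.
move=> mA; apply: (measurableT_comp (f := fine)); last exact: measurable_nu_mballI.
exact: fine_measurable.
Qed.

Lemma measurable_vol r : measurable_fun setT (fun y => vol y r).
Proof.
rewrite (_ : (fun y => _) = fun y => mass y r setT); first exact: measurable_mass.
by apply/funext => y; rewrite setIT.
Qed.


(** * Splitting the Besov energy into dyadic scales *)

Section jump_density.
Context (s : R) (E : set Z).
Hypotheses (s0 : 0 < s) (mE : measurable E).

Let mEC : measurable (~` E). Proof. exact: measurableC. Qed.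
Local Hint Resolve mE mEC : core.

Local Notation rho k := (2^-1 ^+ k : R).

Let rho0 k : 0 < rho k.
Proof. by rewrite exprn_gt0// invr_gt0. Qed.

Let rhoS k : rho k = 2 * rho k.+1.
Proof. by rewrite [in RHS]exprS mulrA divff ?mul1r. Qed.

(* Up to a constant factor, the contribution of the scale [2^-k] to the inner
   Besov integral at [y]; unlike that integral, it is measurable in [y] without
   any joint measurability of the kernel. *)
Definition jump_density (k : nat) (y : Z) : R :=
  ((rho k) `^ s)^-1 * (\1_E y * (mass y (rho k) (~` E) / vol y (rho k))).

Lemma jump_density_ge0 k y : 0 <= jump_density k y.
Proof.
by rewrite !mulr_ge0 ?invr_ge0 ?powR_ge0 ?fine_ge0//.
Qed.

Lemma measurable_jump_density k : measurable_fun setT (jump_density k).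
Proof.
apply: measurable_funM => //; apply: measurable_funM; first exact: measurable_indic.
apply: measurable_funM; first exact: measurable_mass.
(* The reciprocal is rewritten as a power with exponent -1, so that measurability of [powR]
   applies. *)
rewrite (_ : (fun y => _) = (@powR R ^~ (-1)) \o (fun y => vol y (rho k))).
  by apply: measurableT_comp; [exact: measurable_powR|exact: measurable_vol].
by apply/funext => y /=; rewrite powR_inv1// fine_ge0.
Qed.

Let D : R := (1 - 2^-1 `^ s)^-1.

Let D0 : 0 < D.
Proof.
rewrite invr_gt0 subr_gt0 -[ltRHS](congr1 (@^~ s) (powR1 R)).
by rewrite gt0_ltr_powR// ?nnegrE ?invr_ge0// invf_lt1// ltr1n.
Qed.

Let DV_gt0 : 0 < D^-1. Proof. by rewrite invr_gt0; exact: D0. Qed.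
Let DV_ge0 : 0 <= D^-1. Proof. exact: ltW. Qed.

Local Notation K := (besov_kernel dist nu s (\1_E : Z -> R)).

Let K0 y z : 0 <= K y z.
Proof. by rewrite divr_ge0// mulr_ge0 ?powR_ge0// fine_ge0. Qed.

(** For [y] in [E] the left side is the integral over [z] of a step function supported off [E]. It
    lies below the kernel pointwise: only the scales [rho k > dist y z] contribute, there
    [vol y (rho k)] is at least [vol y (dist y z)], and the remaining powers sum to at most [D]
    times [dist y z] to the power [-s]. *)
Lemma sum_jump_density_le N y :
  ((D^-1 * \sum_(k < N) jump_density k y)%:E <= \int[nu]_z (K y z)%:E)%E.
Proof.
have [Ey|nEy] := pselect (E y); last first.
  rewrite big1 ?mulr0; first by apply: integral_ge0 => z _; rewrite lee_fin.
  by move=> k _; rewrite /jump_density indicE memNset// mul0r mulr0.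
pose a k := D^-1 * (((rho k) `^ s)^-1 / vol y (rho k)).
have a0 k : 0 <= a k.
  by rewrite mulr_ge0// divr_ge0 ?invr_ge0 ?powR_ge0 ?fine_ge0.
pose F k := ball y (rho k) `&` ~` E.
have mF k : measurable (F k) by apply: measurableI => //; exact: measurable_mball.
have -> : (D^-1 * \sum_(k < N) jump_density k y)%:E =
    (\int[nu]_z \sum_(k < N) (a k * \1_(F k) z)%:E)%E.
  rewrite ge0_integral_sum//; last 2 first.
  - move=> k; apply/measurable_EFinP; exact: measurable_funM.
  - by move=> k z _; rewrite lee_fin mulr_ge0// indicE ler0n.
  rewrite mulr_sumr -sumEFin; apply: eq_bigr => k _.
  under eq_integral do rewrite EFinM.
  rewrite ge0_integralZl_EFin//; last first.
    by apply/measurable_EFinP; exact/measurable_indic/mF.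
  rewrite integral_indic// setIT -[X in (_ * X)%E]fineK; last first.
    exact: nu_mballI_fin.
  rewrite -EFinM; congr EFin.
  by rewrite /jump_density indicE mem_set// mul1r /a; ring.
apply: ge0_le_lower_integral => z.
  by apply: sume_ge0 => k _; rewrite lee_fin mulr_ge0// indicE ler0n.
rewrite sumEFin lee_fin.
have [Ez|nEz] := pselect (E z).
  rewrite big1// => k _; rewrite indicE memNset ?mulr0//.
  by move=> [].
have yz0 : 0 < dist y z.
  case: distP => d0 dE _ _; rewrite lt_neqAle d0 andbT eq_sym; apply/eqP.
  by move=> /dE yz; apply: nEz; rewrite -yz.
have vyz := vol_gt0 y yz0.
have -> : K y z = (dist y z `^ s)^-1 / vol y (dist y z).
  rewrite /besov_kernel !indicE memNset// mem_set// sub0r normrN normr1.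
  by rewrite div1r invfM.
rewrite ler_pdivlMr// mulr_suml.
have := sum_dyadic_powR_le N s0 yz0; rewrite -/D -ler_pdivrMl//.
apply: le_trans; rewrite mulr_sumr; apply: ler_sum => k _.
rewrite indicE; have [yzk|yzk] := ltP (dist y z) (rho k); last first.
  rewrite memNset ?mulr0 ?mul0r// => -[].
  by rewrite /mball/= ltNge yzk.
rewrite mem_set//= mulr1 /a -mulrA ler_pM2l//.
rewrite -mulrA ler_piMr ?invr_ge0 ?powR_ge0//.
rewrite mulrC ler_pdivrMr ?vol_gt0// mul1r le_vol//.
exact/le_mball/ltW.
Qed.

(** Every partial sum is bounded by [D] times the Besov energy: a finite sum commutes with the
    integral of the measurable densities, and the preceding bound is integrated over [y]. *)
Lemma sum_integral_jump_density_lty :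
  (\int[nu]_y \int[nu]_z (K y z)%:E < +oo)%E ->
  (\sum_(0 <= k <oo) \int[nu]_y (jump_density k y)%:E < +oo)%E.
Proof.
move=> Koo; apply: (@le_lt_trans _ _
    (D%:E * \int[nu]_y \int[nu]_z (K y z)%:E)%E); last first.
  by apply: lte_mul_pinfty => //; rewrite lee_fin ltW.
apply: lime_le.
  apply: is_cvg_nneseries => k _ _; apply: integral_ge0 => y _.
  by rewrite lee_fin jump_density_ge0.
near=> N; rewrite big_mkord -lee_pdivrMl// muleC -ge0_integral_sum//; last 2 first.
- by move=> k; apply/measurable_EFinP; exact: measurable_jump_density.
- by move=> k y _; rewrite lee_fin jump_density_ge0.
rewrite muleC -ge0_integralZl_EFin//; last 2 first.
- by move=> y _; apply: sume_ge0 => k _; rewrite lee_fin jump_density_ge0.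
- apply: emeasurable_sum => k; apply/measurable_EFinP.
  exact: measurable_jump_density.
apply: ge0_le_lower_integral => y.
  apply: mule_ge0; first by rewrite lee_fin.
  by apply: sume_ge0 => k _; rewrite lee_fin jump_density_ge0.
by rewrite sumEFin -EFinM sum_jump_density_le.
Unshelve. all: by end_near. Qed.

(** * Content of the points that see both sides at one scale *)

(** The radius is [rho j.+1] rather than [rho j] so that the ball of radius [rho j] around any point
    of the tested ball contains the tested ball. *)
Definition mixed_at (g : R) (j : nat) : set Z := [set x |
  g * vol x (rho j.+1) <= mass x (rho j.+1) E /\
  g * vol x (rho j.+1) <= mass x (rho j.+1) (~` E)].

(** With [r = rho j.+1] and [y] in [ball x r], the ball of radius [2 * r] around [y] contains
    [ball x r] and lies in the ball of radius [4 * r] around [x]. Two doublings thus give the lower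
    bound [c] for the density on the part of [ball x r] in [E], and a third compares the mass of
    that part with [vol x (rho j)]. *)
Lemma mixed_ball_energy g j x : 0 < g -> mixed_at g j x ->
  (nu (ball x (rho j)) * ((rho j `^ s)^-1)%:E <=
   (C ^+ 3 / g ^+ 2)%:E * \int[nu]_(y in ball x (rho j.+1)) (jump_density j y)%:E)%E.
Proof.
move=> g0 [xE xEC]; set r := rho j.+1.
have r0 : 0 < r by exact: rho0.
have mB : measurable (ball x r) by exact: measurable_mball.
have mBE : measurable (ball x r `&` E) by exact: measurableI.
pose c := (rho j `^ s)^-1 * (g / C ^+ 2).
have w0 : 0 < (rho j `^ s)^-1 by rewrite invr_gt0 powR_gt0.
have c0 : 0 < c by rewrite !mulr_gt0// invr_gt0 exprn_gt0.
have cE y : (ball x r `&` E) y -> c <= jump_density j y.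
  move=> [xy Ey]; rewrite /jump_density indicE mem_set// mul1r ler_pM2l//.
  rewrite ler_pdivlMr ?vol_gt0// mulrAC ler_pdivrMr ?exprn_gt0//.
  have h1 : vol y (rho j) <= vol x (2 * (2 * r)).
    apply: le_vol; apply: subset_trans (mball_sub xy) _.
    by apply: le_mball; rewrite rhoS -/r; lra.
  have h2 : vol x (2 * (2 * r)) <= C ^+ 2 * vol x r.
    have r20 : 0 < 2 * r by rewrite mulr_gt0.
    apply: le_trans (vol_doubling x r20) _; rewrite expr2 -mulrA ler_pM2l//.
    exact: vol_doubling.
  have h3 : mass x r (~` E) <= mass y (rho j) (~` E).
    apply: le_mass => //; apply: subset_trans (mball_sub (mball_sym xy)) _.
    by apply: le_mball; rewrite rhoS -/r; lra.
  apply: (@le_trans _ _ (C ^+ 2 * (g * vol x r))).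
    by rewrite mulrCA ler_pM2l// (le_trans h1).
  by rewrite mulrC ler_pM2r ?exprn_gt0// (le_trans xEC).
have int_ge : ((c * (g / C * vol x (rho j)))%:E <=
    \int[nu]_(y in ball x r) (jump_density j y)%:E)%E.
  have mh D' : measurable_fun D' (EFin \o jump_density j).
    apply/measurable_EFinP; apply: measurable_funTS.
    exact: measurable_jump_density.
  apply: (@le_trans _ _ (\int[nu]_(y in ball x r `&` E) (jump_density j y)%:E)%E);
    last first.
    by apply: ge0_subset_integral => // y _; rewrite lee_fin jump_density_ge0.
  apply: (@le_trans _ _ (\int[nu]_(y in ball x r `&` E) cst c%:E y)%E).
    rewrite integral_cst// EFinM lee_pmul2l// -[leRHS]fineK ?nu_mballI_fin//.
    rewrite lee_fin; apply: le_trans xE; rewrite -mulrA ler_pM2l//.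
    by rewrite mulrC ler_pdivrMr// mulrC rhoS vol_doubling.
  by apply: ge0_le_integral => // y _; rewrite lee_fin ltW.
have -> : (nu (ball x (rho j)) * ((rho j `^ s)^-1)%:E)%E =
    (C ^+ 3 / g ^+ 2 * (c * (g / C * vol x (rho j))))%:E.
  rewrite -[X in (X * _)%E]fineK ?nu_mball_fin// -EFinM; congr EFin.
  rewrite /c; move: (gt_eqF g0) (gt_eqF C0) w0 => gn Cn _.
  field; rewrite gn Cn/= ?andbT; by rewrite gt_eqF ?powR_gt0.
by rewrite EFinM lee_pmul2l// lte_fin divr_gt0 ?exprn_gt0.
Qed.

(** Compactness gives a finite cover by balls of radius [r], from which separated mixed centres are
    extracted. The balls of radius [2 * r = rho j] around them cover, while those of radius [r] are
    disjoint, so their energies add up to at most the total. *)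
Lemma hcontent_mixed_at g j delta : mcompact dist -> 0 < g -> rho j <= delta ->
  (hcontent dist nu s delta (mixed_at g j) <=
   (C ^+ 3 / g ^+ 2)%:E * \int[nu]_y (jump_density j y)%:E)%E.
Proof.
move=> cptZ g0 jdelta; set r := rho j.+1.
have [n [p Zp]] : exists n (p : nat -> Z),
    setT `<=` \bigcup_(k in [set k | (k < n)%N]) ball (p k) r.
  apply: (cptZ Z (fun x => ball x r)) => [x|x _]; first exact: mopen_mball.
  exists x => //; rewrite /mball/=.
  by case: distP => _ dE _ _; rewrite (dE x x).2//; exact: rho0.
have [z [zA sep zcov]] := separated_cover point distP
  (subset_trans (@subsetT _ (mixed_at g j)) Zp).
have jd : 0 < rho j <= delta by rewrite rho0.
rewrite /r -rhoS in zcov sep.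
apply: le_trans (hcontent_le_seq (measure_ge0 nu) s jd zcov) _.
rewrite (big_nth point) big_mkord.
apply: (@le_trans _ _ (\sum_(i < size z) (C ^+ 3 / g ^+ 2)%:E *
   \int[nu]_(y in ball (nth point z i) r) (jump_density j y)%:E)%E).
  by apply: lee_sum => i _; apply: mixed_ball_energy => //; exact: zA.
have h0 y : (0 <= (jump_density j y)%:E)%E by rewrite lee_fin jump_density_ge0.
have mh D' : measurable_fun D' (EFin \o jump_density j).
  apply/measurable_EFinP; apply: measurable_funTS; exact: measurable_jump_density.
rewrite -ge0_sume_distrr; last by move=> i _; apply: integral_ge0.
rewrite lee_pmul2l ?lte_fin ?divr_gt0 ?exprn_gt0//.
pose F (i : 'I_(size z)) := ball (nth point z i) r.
have mF i : measurable (F i) by exact: measurable_mball.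
rewrite -(ge0_integral_bigsetU nu mF (index_enum_uniq _))//.
- apply: ge0_subset_integral => //.
  by apply: bigsetU_measurable => i _; exact: mF.
- apply/trivIsetP => i k _ _ ik; rewrite -subset0 => y [iy ky].
  have := sep i k (ltn_ord i) (ltn_ord k) ik; rewrite leNgt => /negP; apply.
  case: distP => _ _ dC dT; move: iy ky; rewrite /F /mball/= => iy ky.
  have := dT (nth point z i) y (nth point z k); rewrite (dC y).
  by rewrite rhoS -/r; lra.
Qed.

(** * Vanishing content of the measure-theoretic boundary *)

(** The threshold depends on [x]; lowering it to some [2^-1 ^+ n] places the boundary in a countable
    union. *)
Lemma mboundary_mixed_at x : mboundary dist nu E x ->
  exists n, forall m, exists2 j, (m <= j)%N & mixed_at (2^-1 ^+ n) j x.
Proof.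
move=> [xE xEC].
rewrite (_ : (fun r => _) = fun r => mass x r (~` E) / vol x r) in xEC;
    last first.
  by apply/funext => r; rewrite setDE.
have vC r : 0 < r -> vol x (2 * r) <= C * vol x r by exact: vol_doubling.
have mass_homo A : measurable A -> {homo (fun r => mass x r A) : r q / r <= q}.
  by move=> mA r q rq; apply: le_mass => //; exact: le_mball.
have vol_homo : {homo (fun r => vol x r) : r q / r <= q}.
  by move=> r q rq; apply: le_vol; exact: le_mball.
have [a a0 aE] :=
  limsup0_gt0_dyadic C0 (@vol_gt0 x) vC (mass_homo _ mE) vol_homo xE.
have [a' a'0 aEC] :=
  limsup0_gt0_dyadic C0 (@vol_gt0 x) vC (mass_homo _ mEC) vol_homo xEC.
pose e A j := mass x (rho j.+1) A.
have freq A t : Num.min a a' <= t ->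
    (forall m, exists2 j, (m <= j)%N & t * vol x (rho j.+1) <= e A j) ->
    forall m, exists2 j, (m <= j)%N & Num.min a a' * vol x (rho j.+1) <= e A j.
  move=> le_t tA m; have [j mj tj] := tA m; exists j => //.
  by apply: le_trans tj; rewrite ler_wpM2r ?fine_ge0.
have [|||||||g g0 gP] := @frequently_both_ge R C (Num.min a a') (e E) (e (~` E))
    (fun j => vol x (rho j.+1)) C1.
- by rewrite lt_min a0.
- by move=> j; exact: vol_gt0.
- by move=> j; exact: vol_mass.
- by move=> j; rewrite rhoS; exact: vC.
- move=> j; apply: mass_homo => //; rewrite [leRHS]rhoS.
  by have := rho0 j.+2; lra.
- by apply: freq aE; rewrite ge_min lexx.
- by apply: freq aEC; rewrite ge_min lexx orbT.
have [n ng] := half_expr_lt g0; exists n => m.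
have [j mj [jE jEC]] := gP m; exists j => //.
by split; [apply: le_trans jE|apply: le_trans jEC];
  rewrite ler_wpM2r ?fine_ge0// ltW.
Qed.

Lemma hcontent_mboundary_eq0 delta : mcompact dist ->
  (\int[nu]_y \int[nu]_z (K y z)%:E < +oo)%E -> 0 < delta ->
  hcontent dist nu s delta (mboundary dist nu E) = 0%E.
Proof.
move=> cptZ Koo delta0.
pose h k := (\int[nu]_y (jump_density k y)%:E)%E.
have h0 k : (0 <= h k)%E.
  by apply: integral_ge0 => y _; rewrite lee_fin jump_density_ge0.
have hc0 := hcontent_ge0 dist (measure_ge0 nu).
pose L n := [set x | forall m, exists2 j, (m <= j)%N & mixed_at (2^-1 ^+ n) j x].
suff L0 n : hcontent dist nu s delta (L n) = 0%E.
  apply/eqP; rewrite eq_le hc0 andbT.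
  apply: (@le_trans _ _ (hcontent dist nu s delta (\bigcup_n L n))).
    by apply: le_hcontent => x /mboundary_mixed_at[n nx]; exists n.
  apply: le_trans (hcontent_sigma_subadditive _ (measure_ge0 nu) _ _ _) _.
  by rewrite eseries0.
apply/eqP; rewrite eq_le hc0 andbT.
set c := C ^+ 3 / (2^-1 ^+ n) ^+ 2.
(* For each large [m], [L n] lies in the union of the mixed sets of scales [j >= m], whose content
   is at most this tail of a convergent series. *)
have tail : (c%:E * \sum_(m <= k <oo) h k)%E @[m --> \oo] --> (0 : \bar R).
  rewrite -[X in _ --> X](mule0 c%:E); apply: cvgeZl => //.
  apply: nneseries_tail_cvg => //; exact: sum_integral_jump_density_lty.
apply: (cvge_to_ge tail).
have [M Mdelta] := half_expr_lt delta0.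
near=> m; have Mm : (M <= m)%N by near: m; exact: nbhs_infty_ge.
apply: (@le_trans _ _ (hcontent dist nu s delta
    (\bigcup_i mixed_at (2^-1 ^+ n) (i + m)))).
  by apply: le_hcontent => x /(_ m)[j mj xj]; exists (j - m)%N => //; rewrite subnK.
apply: le_trans (hcontent_sigma_subadditive _ (measure_ge0 nu) _ _ _) _.
rewrite -(nneseries_addn m h0) -nneseriesZl//.
apply: lee_nneseries => // i _; apply: hcontent_mixed_at => //.
apply: le_trans (ltW Mdelta).
by rewrite ler_wiXn2l ?invr_ge0 ?invf_le1 ?ler1n// (leq_trans Mm) ?leq_addl.
Unshelve. all: by end_near. Qed.

End jump_density.

End doubling_metric_space.

Theorem theorem1p2 (R : realType) (d : measure_display) (Z : measurableType d)
  (dist : Z -> Z -> R) (nu : {measure set Z -> \bar R}) (s : R) (E : set Z) :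
  is_metric dist -> mcompact dist ->
  borel_regular dist nu -> doubling dist nu ->
  0 < s < 1 ->
  measurable E ->
  besov11 dist nu s (\1_E) ->
  hmeasure dist nu s (mboundary dist nu E) = 0%E.
Proof.
move=> distP cptZ [borelP _] [C [C1 nuP]] /andP[s0 _] mE [_ Koo].
have openP U : mopen dist U -> measurable U.
  by move=> oU; apply: borelP; exact: sub_sigma_algebra.
(* The content already vanishes for every [r > 0], so the limit is that of an eventually constant
   function. *)
apply: lim_near_cst => //; near=> r.
apply: (hcontent_mboundary_eq0 distP openP C1 nuP s0 mE cptZ Koo).
by near: r; exact: nbhs_right_gt.
Unshelve. all: by end_near. Qed.
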